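(* Let $(G,\cdot,e)$ be a group and $\odot$ another binary operation on $G$. Then $(G,\cdot,e,\odot)$ is an identical group-$e$-semigroup if and only if there exists a (unique) strong decomposer function $f:(G,\cdot)\to(G,\cdot)$ such that $\odot=\cdot_f$. Hence, denoting by $Bio(G)$ the set of all binary operations on $G$, $$\{\odot\in Bio(G)\mid (G,\cdot,e,\odot)\text{ is an identical group-}e\text{-semigroup}\}$$ $$=\{\cdot_f\mid f:(G,\cdot)\to(G,\cdot)\text{ is associative and idempotent}\}$$ $$=\{\odot\in Bio(G)\mid (G,\cdot,e,\odot)\text{ is a group-}e\text{-semigroup}\}\cap\{\cdot_f\mid f:(G,\cdot)\to(G,\cdot)\}.$$
   Context: A group-$e$-semigroup $(G,\cdot,e,\odot)$ consists of a group $(G,\cdot)$ with identity element $e$ and a semigroup $(G,\odot)$ on the same set such that $e\odot(xy)=e\odot(x\odot y)$ and $(xy)\odot e=(x\odot y)\odot e$ for all $x,y\in G$ (where $xy=x\cdot y$). It is identical if $e\odot(xy)=e\odot(x\odot y)=x\odot y=(xy)\odot e=(x\odot y)\odot e$ for all $x,y\in G$. For a function $f:G\to G$, the $f$-multiplication is $x\cdot_f y:=f(xy)$. The functions $f^*,f_*$ are defined by $x=f^*(x)f(x)=f(x)f_*(x)$ for all $x\in G$. $f$ is strong decomposer if $f(f^*(x)y)=f(y)$ and $f(xf_*(y))=f(x)$ for all $x,y\in G$; $f$ is associative if $f(xf(yz))=f(f(xy)z)$ for all $x,y,z\in G$; $f$ is idempotent if $f(f(x))=f(x)$ for all $x$.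 All functions $f:(G,\cdot)\to(G,\cdot)$ are arbitrary maps (not assumed homomorphisms). *)

(* Defs.v *)
From mathcomp Require Import all_boot all_fingroup.
From mathcomp Require Import boolp classical_sets.

Set Implicit Arguments.
Unset Strict Implicit.
Unset Printing Implicit Defensive.

Local Open Scope group_scope.

Section Definitions.
Variable G : groupType.
Implicit Types (op : G -> G -> G) (f : G -> G).

(* (G, *, 1, op) is a group-e-semigroup, e being the identity 1 of G. *)
Definition group_e_semigroup op : Prop :=
  [/\ associative op,
      forall x y, op 1 (x * y) = op 1 (op x y)
    & forall x y, op (x * y) 1 = op (op x y) 1].

Definition identical_group_e_semigroup op : Prop :=
  group_e_semigroup op /\
  forall x y, [/\ op 1 (x * y) = op 1 (op x y),
                  op 1 (op x y) = op x y,
                  op x y = op (x * y) 1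
                & op (x * y) 1 = op (op x y) 1].

Definition f_mul f : G -> G -> G := fun x y => f (x * y).

(* f^* and f_*: the unique solutions of x = f^*(x) f(x) = f(x) f_*(x). *)
Definition upper_star f : G -> G := fun x => x * (f x)^-1.
Definition lower_star f : G -> G := fun x => (f x)^-1 * x.

Lemma upper_starP f (g : G -> G) :
  (forall x, x = g x * f x) <-> g = upper_star f.
Proof.
split=> [gP|-> x]; last by rewrite /upper_star mulgKV.
by apply/funext => x; rewrite /upper_star {2}(gP x) mulgK.
Qed.

Lemma lower_starP f (g : G -> G) :
  (forall x, x = f x * g x) <-> g = lower_star f.
Proof.
split=> [gP|-> x]; last by rewrite /lower_star mulVKg.
by apply/funext => x; rewrite /lower_star {3}(gP x) mulKg.
Qed.

Definition strong_decomposer f : Prop :=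
  (forall x y, f (upper_star f x * y) = f y) /\
  (forall x y, f (x * lower_star f y) = f x).

Definition associative_fun f : Prop :=
  forall x y z, f (x * f (y * z)) = f (f (x * y) * z).

End Definitions.

(* Main.v *)
(* Both conditions on f -- being a strong decomposer, and being associative and
   idempotent -- say that f (x y) = f (f x y) = f (x f y), and f is recovered
   from op = f_mul f as f = op 1. *)
Require Import Defs.
From mathcomp Require Import all_boot all_fingroup.
From mathcomp Require Import boolp classical_sets.

Local Open Scope classical_set_scope.

Section StrongDecomposer.
Local Open Scope group_scope.
Variable G : groupType.
Implicit Types (op : G -> G -> G) (f : G -> G).

(** The pivot is [absorbing]: inside [f], a factor may be replaced by its image. For [op = f_mul f],
    the semigroup axioms reduce to associativity and idempotence of [f]. Identicality supplies such
    an [f], since [op x y = op 1 (x * y)]. *)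

Definition absorbing f : Prop :=
  (forall x y, f (f x * y) = f (x * y)) /\ (forall x y, f (x * f y) = f (x * y)).

(** A change of variable: substituting [f x * y] for [y] cancels the inverse in [upper_star f x],
    leaving [x * y]; the right-hand law is symmetric. *)
Lemma strong_decomposer_absorbing f : strong_decomposer f <-> absorbing f.
Proof.
rewrite /strong_decomposer /upper_star /lower_star; split=> -[fl fr].
  split=> x y; first by rewrite -[LHS](fl x) mulgA mulgVK.
  by rewrite -[LHS](fr _ y) mulgA mulgK.
split=> x y; first by rewrite -mulgA -fl mulVKg.
by rewrite mulgA -fr mulgVK.
Qed.

(** Putting 1 for an outer variable of associativity leaves [f (f (x * y))] on one side, which
    idempotence collapses. Conversely, both sides of associativity absorb to [f (x * y * z)]. *)
Lemma associative_idempotent_absorbing f :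
  associative_fun f /\ idempotent_fun f <-> absorbing f.
Proof.
split=> [[fA ff]|[fl fr]].
  split=> x y; first by have := fA 1 x y; rewrite !mul1g => <-; exact: ff.
  by have := fA x y 1; rewrite !mulg1 => ->; exact: ff.
split=> [x y z|x]; first by rewrite fr fl mulgA.
by have /= := fl x 1; rewrite !mulg1.
Qed.

Lemma strong_decomposerE f :
  strong_decomposer f <-> associative_fun f /\ idempotent_fun f.
Proof.
exact: iff_trans (strong_decomposer_absorbing f)
  (iff_sym (associative_idempotent_absorbing f)).
Qed.

(** Gives the uniqueness of [f]. *)
Lemma f_mul_inj : injective (@f_mul G).
Proof.
move=> f g fg; apply/funext => x.
by have := congr1 (fun op => op 1 x) fg; rewrite /f_mul mul1g.
Qed.

(** Associativity of [f_mul f] is literally that of [f], and both laws at 1 read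
    [f (x * y) = f (f (x * y))]. *)
Lemma group_e_semigroup_f_mul f :
  group_e_semigroup (f_mul f) <-> associative_fun f /\ idempotent_fun f.
Proof.
rewrite /group_e_semigroup /f_mul; split=> [[fA fl _]|[fA ff]].
  by split=> // x /=; have := fl 1 x; rewrite !mul1g.
by split=> // x y; rewrite ?mul1g ?mulg1; exact/esym/ff.
Qed.

Lemma identical_group_e_semigroupP op :
  identical_group_e_semigroup op <->
  exists f, (associative_fun f /\ idempotent_fun f) /\ op = f_mul f.
Proof.
split=> [[opG opE]|[f [fP ->]]].
  have opf : op = f_mul (op 1).
    (* The chain is [op 1 (x * y) = op 1 (op x y) = op x y]. *)
    by apply/funext => x; apply/funext => y; rewrite /f_mul; case: (opE x y) => -> ->.
  by exists (op 1); split=> //; apply/group_e_semigroup_f_mul; rewrite -opf.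
split; first exact/group_e_semigroup_f_mul.
by case: fP => _ ff x y; rewrite /f_mul !mul1g !mulg1; split=> //; first [exact: ff | exact/esym/ff].
Qed.

End StrongDecomposer.

Theorem theorem3p4 (G : groupType) :
  (forall op : G -> G -> G,
     (identical_group_e_semigroup op <->
        exists f : G -> G, strong_decomposer f /\ op = f_mul f) /\
     (identical_group_e_semigroup op <->
        exists! f : G -> G, strong_decomposer f /\ op = f_mul f)) /\
  [set op : G -> G -> G | identical_group_e_semigroup op] =
    [set f_mul f | f in [set f : G -> G |
                           associative_fun f /\ idempotent_fun f]] /\
  [set f_mul f | f in [set f : G -> G |
                         associative_fun f /\ idempotent_fun f]] =
    [set op : G -> G -> G | group_e_semigroup op] `&`
      [set f_mul f | f in [set: G -> G]].
Proof.
have idP (op : G -> G -> G) : identical_group_e_semigroup op <->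
    exists f : G -> G, strong_decomposer f /\ op = f_mul f.
  apply: iff_trans (identical_group_e_semigroupP G op) _.
  by split=> -[f [/strong_decomposerE fP ->]]; exists f.
split=> [op|]; last split.
- split=> //; apply: iff_trans (idP op) _.
  split=> [[f [fP opf]]|[f [fP _]]]; last by exists f.
  by exists f; split=> // g [_]; rewrite opf => /f_mul_inj.
- apply/seteqP; split=> [op /identical_group_e_semigroupP[f [fP ->]]|_ [f fP <-]].
    by exists f.
  by apply/identical_group_e_semigroupP; exists f.
- apply/seteqP; split=> [_ [f fP <-]|op [opG [f _ fop]]].
    by split; [exact/group_e_semigroup_f_mul | exists f].
  by exists f => //; apply/group_e_semigroup_f_mul; rewrite fop.
Qed.
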